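(* Every signed graph built from $(K_3,-)$ by repeated applications of operations [1] and [2] described below admits a balanced $(83,41)$-coloring.
   Context: A signed graph $(G,\sigma)$ is a graph with a signature $\sigma:E(G)\to\{+,-\}$; a cycle is negative if it has an odd number of negative edges; a vertex set is balanced if it induces no negative cycle. A balanced $(p,q)$-coloring assigns to each vertex a set of $q$ colors from $\{1,\dots,p\}$ so that each color class is balanced. $(K_n,-)$ denotes $K_n$ with all edges negative. Switching at a vertex multiplies the signs of all its incident edges by $-1$; two signed graphs are switching equivalent if one can be obtained from the other by a sequence of switchings. The signed graph $\widehat{W}$: vertices $u,v,w,z,t,x_1,\dots,x_5$; edges $wx_i$ ($1\le i\le5$), $x_1x_2,x_2x_3,x_3x_4,x_4x_5,x_5x_1$, $zx_2,zx_3,zu,zv$, $tx_4,tx_5,tu,tv$, $ux_1,ux_2,ux_5,uv$, $vx_3,vx_4$; the edges $ux_2$ and $vx_4$ are positive and all others negative. The signed graph $\widehat{W}'$ is obtained from $\widehat{W}$ by adding vertices $a_1,a_2,a_3,b_1,b_2,b_3$ with negative edges $a_1a_2,a_2a_3,a_1a_3,a_1x_1,a_1x_2,a_2u$, positive edges $a_2x_2,a_3u,a_3x_1$, negative edges $b_1b_2,b_2b_3,b_1b_3,b_1x_3,b_1x_4,b_2v$ and positive edges $b_2x_4,b_3v,b_3x_3$. The graphs are built as plane signed graphs starting from $(K_3,-)$, using: [1] Insert a new vertex inside a facial negative triangle, join it to the three vertices of the triangle, and assign signs to the three new edges so that the resulting signed $K_4$ is switching equivalent to $(K_4,-)$. [2]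 Given an edge $xy$ of a previously built signed graph, add a copy of $\widehat{W}'$ with its edge $uv$ identified with $xy$ (switching the copy if needed so that the sign of $uv$ agrees with that of $xy$). *)

(* Defs.v *)
From mathcomp Require Import all_boot.
Set Implicit Arguments.
Unset Strict Implicit.
Unset Printing Implicit Defensive.

(* The signature is encoded by the set [neg] of negative edges. *)
Record sgraph (V : finType) := SGraph {
  adj : rel V;
  neg : rel V;
  adj_sym : symmetric adj;
  adj_irr : irreflexive adj;
  neg_sym : symmetric neg;
  neg_adj : subrel neg adj
}.

Definition same_sgraph (V : finType) (G H : sgraph V) : Prop :=
  adj G =2 adj H /\ neg G =2 neg H.

Section Cycles.
Variables (V : finType) (G : sgraph V).

Definition is_cycle (c : seq V) : bool := (2 < size c) && ucycleb (adj G) c.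

Definition negative_cycle (c : seq V) : bool :=
  is_cycle c && odd (count (fun x => neg G x (next c x)) c).

Definition balanced (A : {set V}) : Prop :=
  forall c : seq V, {subset c <= A} -> ~~ negative_cycle c.

Definition balanced_coloring (p q : nat) (c : V -> {set 'I_p}) : Prop :=
  (forall x, #|c x| = q) /\ (forall i : 'I_p, balanced [set x | i \in c x]).

End Cycles.

Section Switching.
Variable V : finType.

Section SwitchAt.
Variables (G : sgraph V) (v : V).

Definition switch_neg : rel V :=
  fun x y => adj G x y && (neg G x y (+) ((x == v) (+) (y == v))).

Lemma switch_neg_sym : symmetric switch_neg.
Proof.
by move=> x y; rewrite /switch_neg adj_sym neg_sym [(x == v) (+) _]addbC.
Qed.

Lemma switch_neg_adj : subrel switch_neg (adj G).
Proof. by move=> x y /andP[]. Qed.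

Definition switch_at : sgraph V :=
  SGraph (adj_sym G) (adj_irr G) switch_neg_sym switch_neg_adj.

End SwitchAt.

Definition switching_equiv (G H : sgraph V) : Prop :=
  exists s : seq V, same_sgraph (foldl switch_at G s) H.

End Switching.

(* For an injective [f], the subgraph of [G] induced on the image of [f],
   transported to the source of [f]. *)
Section Induced.
Variables (U V : finType) (f : U -> V) (G : sgraph V).

Lemma induced_adj_sym : symmetric (fun x y => adj G (f x) (f y)).
Proof. by move=> x y; exact: adj_sym. Qed.
Lemma induced_adj_irr : irreflexive (fun x y => adj G (f x) (f y)).
Proof. by move=> x; exact: adj_irr. Qed.
Lemma induced_neg_sym : symmetric (fun x y => neg G (f x) (f y)).
Proof. by move=> x y; exact: neg_sym. Qed.
Lemma induced_neg_adj :
  subrel (fun x y => neg G (f x) (f y)) (fun x y => adj G (f x) (f y)).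
Proof. by move=> x y; exact: neg_adj. Qed.

Definition induced : sgraph U :=
  SGraph induced_adj_sym induced_adj_irr induced_neg_sym induced_neg_adj.

End Induced.

Section NegativeComplete.
Variable V : finType.

Lemma neqb_sym : symmetric (fun x y : V => x != y).
Proof. by move=> x y; rewrite eq_sym. Qed.
Lemma neqb_irr : irreflexive (fun x y : V => x != y).
Proof. by move=> x; rewrite eqxx. Qed.

Definition negative_complete : sgraph V :=
  SGraph neqb_sym neqb_irr neqb_sym (fun x y h => h).

End NegativeComplete.

(* The signed graph on {0, ..., n-1} with given lists of positive and of
   negative edges, each edge being listed once, in either order. *)
Section OfEdges.
Variables (n : nat) (pos_edges neg_edges : seq (nat * nat)).

Definition listed (s : seq (nat * nat)) : rel 'I_n := fun i j =>
  (i != j) && (((i : nat, j : nat) \in s) || ((j : nat, i : nat) \in s)).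

Lemma listed_sym s : symmetric (listed s).
Proof. by move=> i j; rewrite /listed eq_sym orbC. Qed.
Lemma listed_irr s : irreflexive (listed s).
Proof. by move=> i; rewrite /listed eqxx. Qed.
Lemma listed_neg : subrel (listed neg_edges) (listed (pos_edges ++ neg_edges)).
Proof.
move=> i j /andP[ij h]; rewrite /listed ij !mem_cat /=.
by case/orP: h => ->; rewrite !orbT.
Qed.

Definition sgraph_of_edges : sgraph 'I_n :=
  SGraph (@listed_sym (pos_edges ++ neg_edges))
    (@listed_irr (pos_edges ++ neg_edges)) (@listed_sym neg_edges) listed_neg.

End OfEdges.

Module What.

Definition u := 0. Definition v := 1. Definition w := 2.
Definition z := 3. Definition t := 4.
Definition x1 := 5. Definition x2 := 6. Definition x3 := 7.
Definition x4 := 8. Definition x5 := 9.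
Definition a1 := 10. Definition a2 := 11. Definition a3 := 12.
Definition b1 := 13. Definition b2 := 14. Definition b3 := 15.

Definition pos_edges : seq (nat * nat) := [:: (u, x2); (v, x4)].

Definition neg_edges : seq (nat * nat) :=
  [:: (w, x1); (w, x2); (w, x3); (w, x4); (w, x5);
      (x1, x2); (x2, x3); (x3, x4); (x4, x5); (x5, x1);
      (z, x2); (z, x3); (z, u); (z, v);
      (t, x4); (t, x5); (t, u); (t, v);
      (u, x1); (u, x5); (u, v);
      (v, x3)].

Definition pos_edges' : seq (nat * nat) :=
  pos_edges ++
  [:: (a2, x2); (a3, u); (a3, x1);
      (b2, x4); (b3, v); (b3, x3)].

Definition neg_edges' : seq (nat * nat) :=
  neg_edges ++
  [:: (a1, a2); (a2, a3); (a1, a3); (a1, x1); (a1, x2); (a2, u);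
      (b1, b2); (b2, b3); (b1, b3); (b1, x3); (b1, x4); (b2, v)].

Definition W' : sgraph 'I_16 := sgraph_of_edges 16 pos_edges' neg_edges'.

Definition W'_u : 'I_16 := @Ordinal 16 u isT.
Definition W'_v : 'I_16 := @Ordinal 16 v isT.

End What.

(* Combinatorial embeddings.  [rot x y] is the neighbour of [x] that follows
   [y] in the cyclic order of the edges around [x]; its values for [y] not
   adjacent to [x] are irrelevant. *)
Section Embedding.
Variables (V : finType) (G : sgraph V) (rot : V -> V -> V).

Definition darts : {set V * V} := [set d | adj G d.1 d.2].

Definition edges : {set {set V}} := [set [set d.1; d.2] | d in darts].

Definition is_rotation : Prop :=
  forall x y, adj G x y -> fconnect (rot x) y =1 adj G x.

Definition face_step (d : V * V) : V * V := (d.2, rot d.2 d.1).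

Definition faces : {set {set V * V}} :=
  [set [set e | fconnect face_step d e] | d in darts].

End Embedding.

Record plane_sgraph (V : finType) := PlaneSGraph {
  psg :> sgraph V;
  rot : V -> V -> V;
  rotP : is_rotation psg rot;
  plane_connected : forall x y, connect (adj psg) x y;
  plane_euler : #|V| + #|faces psg rot| = #|edges psg| + 2
}.

(* The closed walk a, b, c, a is the boundary walk of a face. *)
Definition facial_triangle (V : finType) (G : plane_sgraph V) (a b c : V) :
    Prop :=
  [/\ adj G a b, adj G b c & adj G c a] /\
  [/\ rot G b a = c, rot G c b = a & rot G a c = b].

(* [f] identifies [H] with an induced subgraph of [G], with the same signs,
   and the embedding of [H] is the one obtained from the embedding of [G] by
   deleting the vertices outside the image of [f]. *)
Definition plane_embedding (U V : finType) (f : U -> V)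
    (H : plane_sgraph U) (G : plane_sgraph V) : Prop :=
  [/\ injective f,
      same_sgraph (induced f G) H
    & forall x y, adj H x y -> exists n : nat,
        iter n.+1 (rot G (f x)) (f y) = f (rot H x y) /\
        forall i, i < n -> iter i.+1 (rot G (f x)) (f y) \notin codom f].

(* [G] is obtained from [H] by inserting a vertex inside a facial negative
   triangle. *)
Definition triangle_insertion (U V : finType)
    (H : plane_sgraph U) (G : plane_sgraph V) : Prop :=
  exists (f : U -> V) (n : V) (a b c : U),
    [/\ facial_triangle H a b c,
        negative_cycle H [:: a; b; c]
      & plane_embedding f H G] /\
    [/\ n \notin codom f,
        forall p, p = n \/ p \in codom f
      & forall p, adj G n p = (p \in [:: f a; f b; f c])] /\
    [/\ facial_triangle G (f a) (f b) n,
        facial_triangle G (f b) (f c) n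
      & facial_triangle G (f c) (f a) n] /\
    switching_equiv (induced (tnth [tuple f a; f b; f c; n]) G)
      (negative_complete 'I_4).

(* [G] is obtained from [H] by adding a copy [g] of W' (up to switching) whose
   edge uv is identified with the edge xy of [H]; the sign of uv in the
   switched copy agrees with that of xy since both are read off [G]. *)
Definition W'_addition (U V : finType)
    (H : plane_sgraph U) (G : plane_sgraph V) : Prop :=
  exists (f : U -> V) (g : 'I_16 -> V) (x y : U),
    [/\ adj H x y,
        plane_embedding f H G,
        injective g
      & switching_equiv What.W' (induced g G)] /\
    [/\ f x = g What.W'_u,
        f y = g What.W'_v
      & forall p q, f p = g q -> p = x \/ p = y] /\
    (forall p, p \in codom f \/ p \in codom g) /\
    (forall p q, adj G p q ->
       (p \in codom f /\ q \in codom f) \/ (p \in codom g /\ q \in codom g)).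

Inductive built : forall V : finType, plane_sgraph V -> Prop :=
| built_K3 (V : finType) (G : plane_sgraph V) :
    #|V| = 3 -> same_sgraph G (negative_complete V) -> built G
| built_triangle (U V : finType) (H : plane_sgraph U) (G : plane_sgraph V) :
    built H -> triangle_insertion H G -> built G
| built_W' (U V : finType) (H : plane_sgraph U) (G : plane_sgraph V) :
    built H -> W'_addition H G -> built G.

(* Main.v *)
(** Every colour class is kept balanced by carrying a potential, i.e. a switching
    of the class that makes all its edges positive, and one maintains that the
    colour sets of two adjacent vertices share 12, 13 or 14 colours.  Any two of
    three 41-subsets of an 83-set that pairwise share at most 14 elements share
    at least 12, so only the upper bound has to be watched at a new vertex.
    - Inserting a vertex in a negative triangle: no colour is on all three
      vertices, and a colour is usable at the new vertex exactly when it is on at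
      most one of them.  The number of colours on two of them is 40, 41 or 42,
      which leaves enough usable colours even if at most 14 are taken from each
      of the three sets.
    - Adding W': up to a permutation of the colours, the colouring of an edge is
      determined by the number 12, 13 or 14 of common colours, and for each of
      the three values a colouring of W' is given explicitly.  Potentials can be
      glued along an edge after complementing one of them. *)
Require Import Defs.
From mathcomp Require Import all_boot perm zify.

Set Implicit Arguments.
Unset Strict Implicit.
Unset Printing Implicit Defensive.

(** * Potentials *)

(** This is Harary's bipartition criterion: inside [A] the negative edges are exactly those joining
    the two sides of [s]. *)
Definition potential (V : finType) (G : sgraph V) (A : {set V})
    (s : V -> bool) : Prop :=
  forall x y, x \in A -> y \in A -> adj G x y -> neg G x y = s x (+) s y.

Lemma odd_count (T : Type) (P : pred T) (c : seq T) :
  odd (count P c) = \big[addb/false]_(x <- c) P x.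
Proof.
by elim: c => [|x c IH]; rewrite ?big_nil // big_cons /= oddD IH; case: (P x).
Qed.

Lemma perm_map_next (T : eqType) (c : seq T) :
  uniq c -> perm_eq (map (next c) c) c.
Proof.
move=> Uc; have Um : uniq (map (next c) c).
  by rewrite map_inj_uniq //; apply: can_inj (prev_next Uc).
apply: uniq_perm => //; apply: (uniq_min_size Um _ _).2; rewrite ?size_map //.
by move=> y /mapP[x xc ->]; rewrite mem_next.
Qed.

(** Around a cycle the sum of [s x (+) s (next c x)] vanishes: [next c] permutes the vertices of the
    cycle, so every value of [s] occurs twice. *)
Lemma potential_balanced (V : finType) (G : sgraph V) (A : {set V}) s :
  potential G A s -> balanced G A.
Proof.
move=> sP c cA; rewrite /negative_cycle /is_cycle.
apply/negP=> /andP[/andP[_ /andP[cyc Uc]]]; apply/negP; rewrite odd_count.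
rewrite (eq_big_seq (fun x => s x (+) s (next c x))); last first.
  by move=> x xc; apply: sP; rewrite ?cA ?mem_next // (next_cycle cyc).
rewrite big_split /= -(big_map (next c) predT s).
by rewrite (perm_big _ (perm_map_next Uc)) addbb.
Qed.

Lemma negative_triangle_neg (V : finType) (G : sgraph V) (a b c : V) :
  negative_cycle G [:: a; b; c] -> neg G a b (+) neg G b c (+) neg G c a.
Proof.
case/andP=> /and3P[_ _]; rewrite /= !inE negb_or andbT.
case/andP=> /andP[ab ac] bc.
rewrite !eqxx (eq_sym b a) (eq_sym c a) (eq_sym c b).
rewrite (negPf ab) (negPf ac) (negPf bc).
by case: (neg G a b); case: (neg G b c); case: (neg G c a).
Qed.

Definition good (V : finType) (G : sgraph V) (c : V -> {set 'I_83}) : Prop :=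
  [/\ forall x, #|c x| = 41,
      forall x y, adj G x y -> 12 <= #|c x :&: c y| <= 14
    & forall i, exists s, potential G [set x | i \in c x] s].

Lemma good_balanced_coloring (V : finType) (G : sgraph V) c :
  good G c -> balanced_coloring G 41 c.
Proof.
by case=> c41 _ cP; split=> // i; have [s /potential_balanced] := cP i.
Qed.

(** Colour sets and potentials both compose with a sign-preserving homomorphism. This serves to
    replace a signed graph by an equal one and to colour the starting triangle from [W']. *)
Lemma good_pullback (U V : finType) (h : V -> U)
    (G : sgraph V) (H : sgraph U) c :
  (forall x y, adj G x y ->
     adj H (h x) (h y) /\ neg G x y = neg H (h x) (h y)) ->
  good H c -> good G (c \o h).
Proof.
move=> hP [c41 ce cP]; split=> [x|x y xy|i]; first exact: c41.
  by case: (hP _ _ xy) => /ce.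
have [s sP] := cP i; exists (s \o h) => x y; rewrite !inE => xi yi.
by case/hP=> xy ->; apply: sP; rewrite ?inE.
Qed.

Lemma good_same (V : finType) (G H : sgraph V) c :
  same_sgraph G H -> good H c -> good G c.
Proof.
by case=> eqa eqn; apply: (@good_pullback _ _ id) => x y; rewrite eqa eqn.
Qed.

(** An injective self-map of a finite set is bijective, so this is a renaming of the colours: colour
    [i] takes over the class, and the potential, of colour [r i]. *)
Lemma good_inj (V : finType) (G : sgraph V) c (r : 'I_83 -> 'I_83) :
  injective r -> good G c -> good G (fun x => r @^-1: c x).
Proof.
move=> rI; have cardr (A : {set 'I_83}) : #|r @^-1: A| = #|A|.
  rewrite on_card_preimset //.
  have [r' rK r'K] := injF_bij rI; exists r' => i _; [exact: rK | exact: r'K].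
case=> c41 ce cP; split=> [x|x y xy|i]; first by rewrite cardr.
  by rewrite -preimsetI cardr; apply: ce.
have [s sP] := cP (r i); exists s => x y; rewrite !inE => xi yi.
by apply: sP; rewrite inE.
Qed.

(** Repeated switchings at one vertex cancel in pairs, so only parities of occurrences survive. The
    sign formula is restricted to edges because [switch_neg] is false elsewhere. *)
Lemma foldl_switch_at (V : finType) (G : sgraph V) (s : seq V) x y :
  adj (foldl (@switch_at V) G s) x y = adj G x y /\
  (adj G x y -> neg (foldl (@switch_at V) G s) x y =
     neg G x y (+) odd (count_mem x s) (+) odd (count_mem y s)).
Proof.
elim: s G => [|v s IH] G /=; first by rewrite !addbF.
have [-> IHn] := IH (switch_at G v); split=> // xy; rewrite IHn //=.
rewrite /switch_neg xy /= !oddD !oddb (eq_sym v x) (eq_sym v y).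
by case: (neg G x y); case: (x == v); case: (y == v); do 2!case: (odd _).
Qed.

(** The colour sets stay the same; each potential absorbs the switching by adding the parity of the
    number of switchings at each vertex. *)
Lemma good_switching_equiv (V : finType) (G H : sgraph V) c :
  switching_equiv G H -> good G c -> good H c.
Proof.
case=> t [eqa eqn] [c41 ce cP]; have tP := foldl_switch_at G t.
split=> [//|x y|i]; first by rewrite -eqa (tP x y).1; apply: ce.
have [s sP] := cP i; exists (fun x => s x (+) odd (count_mem x t)) => x y xi yi.
rewrite -eqa -eqn (tP x y).1 => xy; rewrite (tP x y).2 // (sP x y xi yi xy).
by case: (s x); case: (s y); do 2!case: (odd _).
Qed.

(** * Gluing along an edge *)

(** Complementing a potential leaves it a potential, so for each colour the potential on the [g]
    side can be shifted by a constant until it agrees with the other one on the shared edge. Every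
    edge of [G] lies on one of the two sides, so nothing else has to be checked. *)
Lemma good_glue (U W V : finType) (f : U -> V) (g : W -> V) (G : sgraph V)
    (x y : U) (u v : W) c1 c2 :
  injective f -> injective g ->
  good (induced f G) c1 -> good (induced g G) c2 ->
  adj G (f x) (f y) -> f x = g u -> f y = g v ->
  (forall p q, f p = g q -> p = x \/ p = y) ->
  (forall p, p \in codom f \/ p \in codom g) ->
  (forall p q, adj G p q ->
     (p \in codom f /\ q \in codom f) \/ (p \in codom g /\ q \in codom g)) ->
  c1 x = c2 u -> c1 y = c2 v ->
  exists c, good G c.
Proof.
move=> fI gI [f41 fe fP] [g41 ge gP] xy fx fy fg cov adjP cx cy.
(* The same operator glues colour sets and potentials. The default [d] is never reached, since [f]
   and [g] together cover [V]. *)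
pose glue (T : Type) (F : U -> T) (F' : W -> T) (d : T) p :=
  if [pick a | f a == p] is Some a then F a else
  if [pick b | g b == p] is Some b then F' b else d.
have glue_f T F F' (d : T) a : glue T F F' d (f a) = F a.
  by rewrite /glue; case: pickP => [b /eqP/fI-> //|/(_ a)]; rewrite eqxx.
have glue_g T F F' (d : T) b :
    (b = u -> F x = F' u) -> (b = v -> F y = F' v) ->
    glue T F F' d (g b) = F' b.
  move=> Fx Fy; rewrite /glue; case: pickP => [a /eqP fa|_].
    move: (fa); case: (fg _ _ fa) => ->.
      by rewrite fx => /gI/esym eb; rewrite eb Fx.
    by rewrite fy => /gI/esym eb; rewrite eb Fy.
  by case: pickP => [a /eqP/gI-> //|/(_ b)]; rewrite eqxx.
pose c := glue _ c1 c2 set0.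
have cf a : c (f a) = c1 a by exact: glue_f.
have cg b : c (g b) = c2 b by apply: glue_g.
exists c; split.
- by move=> p; case: (cov p) => /codomP[a ->]; rewrite ?cf ?cg.
- move=> p q pq; move: (pq).
  case: (adjP _ _ pq) => -[/codomP[a ->] /codomP[b ->]].
    by rewrite !cf; apply: fe.
  by rewrite !cg; apply: ge.
move=> i; have [s1 s1P] := fP i; have [s2 s2P] := gP i.
(* The shift is read off at an end of the shared edge that carries colour [i]; if neither end does,
   no shift is made. *)
pose d := if i \in c1 x then s1 x (+) s2 u
          else (i \in c1 y) && (s1 y (+) s2 v).
pose s := glue _ s1 (fun b => s2 b (+) d) false.
have sf a : s (f a) = s1 a by exact: glue_f.
have du : i \in c2 u -> s1 x = s2 u (+) d.
  by rewrite /d -cx => ->; case: (s1 x); case: (s2 u).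
(* If both ends carry [i], the sign of the shared edge is the difference of either potential along
   it, so the shift chosen at [x] also fits at [y]. *)
have dv : i \in c2 v -> s1 y = s2 v (+) d.
  rewrite /d -cy => iy; rewrite iy; case: ifP => [ix|_]; last first.
    by case: (s1 y); case: (s2 v).
  have := s1P x y; rewrite !inE ix iy => /(_ isT isT xy) /= E1.
  have := s2P u v; rewrite !inE -cx -cy ix iy /= -fx -fy => /(_ isT isT xy).
  by rewrite E1; case: (s1 x); case: (s1 y); case: (s2 u); case: (s2 v).
have sg b : i \in c2 b -> s (g b) = s2 b (+) d.
  by move=> ib; apply: glue_g => eb; [apply: du | apply: dv]; rewrite -eb.
exists s => p q; rewrite !inE => ip iq pq; move: (pq) ip iq.
case: (adjP _ _ pq) => -[/codomP[a ->] /codomP[b ->]] ab.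
  by rewrite !cf !sf => ia ib; apply: s1P; rewrite ?inE.
rewrite !cg => ia ib; rewrite !sg //.
have := s2P a b; rewrite !inE ia ib => /(_ isT isT ab) /= ->.
by rewrite addbACA addbb addbF.
Qed.

(** * Three sets of 41 colours *)

(** By inclusion-exclusion the union has at least 123 minus this sum elements, and at most 83. Two
    intersections of size at most 14 thus force the third to have at least 12. *)
Lemma card_pairwise_ge (A B C : {set 'I_83}) :
  #|A| = 41 -> #|B| = 41 -> #|C| = 41 ->
  40 <= #|A :&: B| + #|A :&: C| + #|B :&: C|.
Proof.
move=> A41 B41 C41.
have := subset_leq_card (subsetT (A :|: B :|: C)); rewrite cardsT card_ord.
have := cardsUI A B; have := cardsUI (A :|: B) C; rewrite setIUl.
have := cardsUI (A :&: C) (B :&: C); lia.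
Qed.

Lemma ex_subset_card (T : finType) (A : {set T}) k :
  k <= #|A| -> exists2 B : {set T}, B \subset A & #|B| = k.
Proof.
move=> kA; exists [set x in take k (enum A)].
  by apply/subsetP=> x; rewrite inE => /mem_take; rewrite mem_enum.
rewrite cardsE (card_uniqP _) ?take_uniq ?enum_uniq //.
by rewrite size_takel // -cardE.
Qed.

Lemma cardsU_disjoint (T : finType) (A B : {set T}) :
  A :&: B = set0 -> #|A :|: B| = #|A| + #|B|.
Proof. by move=> AB; rewrite cardsU AB cards0 subn0. Qed.

(** With no element common to all three sets, [A] splits into the part shared with [B], the part
    shared with [C] and a private part. *)
Lemma card_private (T : finType) (A B C : {set T}) :
  A :&: B :&: C = set0 ->
  #|A| = #|A :&: B| + #|A :&: C| + #|A :\: (B :|: C)|.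
Proof.
move=> ABC0; rewrite -(cardsID (B :|: C) A) setIUr cardsU_disjoint //.
apply/setP=> i; have := in_set0 i; rewrite -ABC0 !inE.
by case: (i \in A); case: (i \in B); case: (i \in C).
Qed.

(** The set [N] is drawn from the colours outside all three sets and from at most 14 private colours
    of each. The cap gives the bounds on intersections, and avoiding shared colours gives the empty
    triple intersections. *)
Lemma ex_fourth_set (A B C : {set 'I_83}) :
  #|A| = 41 -> #|B| = 41 -> #|C| = 41 -> A :&: B :&: C = set0 ->
  #|A :&: B| <= 14 -> #|A :&: C| <= 14 -> #|B :&: C| <= 14 ->
  exists N : {set 'I_83},
    [/\ #|N| = 41, N :&: A :&: B = set0, N :&: A :&: C = set0
      & N :&: B :&: C = set0] /\
    [/\ #|N :&: A| <= 14, #|N :&: B| <= 14 & #|N :&: C| <= 14].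
Proof.
move=> A41 B41 C41 ABC0 leAB leAC leBC.
have cA := card_private ABC0.
have BAC0 : B :&: A :&: C = set0 by rewrite [B :&: A]setIC.
have CAB0 : C :&: A :&: B = set0 by rewrite -setIA setIC.
have cB := card_private BAC0; have cC := card_private CAB0.
rewrite (setIC B A) in cB; rewrite (setIC C A) (setIC C B) in cC.
have [A' sA' cA'] := ex_subset_card (geq_minr 14 #|A :\: (B :|: C)|).
have [B' sB' cB'] := ex_subset_card (geq_minr 14 #|B :\: (A :|: C)|).
have [C' sC' cC'] := ex_subset_card (geq_minr 14 #|C :\: (A :|: B)|).
have inA' i : i \in A' -> [&& i \in A, i \notin B & i \notin C].
  by move/(subsetP sA'); rewrite !inE negb_or andbC.
have inB' i : i \in B' -> [&& i \notin A, i \in B & i \notin C].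
  move/(subsetP sB'); rewrite !inE negb_or -andbA.
  by rewrite [(i \notin C) && _]andbC.
have inC' i : i \in C' -> [&& i \notin A, i \notin B & i \in C].
  by move/(subsetP sC'); rewrite !inE negb_or -andbA.
pose D := ~: (A :|: B :|: C).
(* Inclusion-exclusion with [123 = 3 * 41], written additively to avoid truncated subtraction. *)
have cD : #|D| + 123 = 83 + (#|A :&: B| + #|A :&: C| + #|B :&: C|).
  have := cardsC (A :|: B :|: C); rewrite card_ord -/D.
  have := cardsUI A B; have := cardsUI (A :|: B) C; rewrite setIUl.
  have := cardsUI (A :&: C) (B :&: C).
  have -> : A :&: C :&: (B :&: C) = set0 by rewrite -setIIl -ABC0.
  rewrite cards0; lia.
pose M := D :|: A' :|: B' :|: C'.
have cM : #|M| = #|D| + #|A'| + #|B'| + #|C'|.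
  rewrite !cardsU_disjoint //; apply/setP=> i; rewrite !inE;
    have := inA' i; have := inB' i; have := inC' i;
    case: (i \in A'); case: (i \in B'); case: (i \in C');
    case: (i \in A); case: (i \in B); case: (i \in C) => //= H1 H2 H3;
    solve [ by move: (H1 isT) | by move: (H2 isT) | by move: (H3 isT) ].
(* Let [s] be the sum of the pairwise intersections: [40 <= s <= 42] and [D] has [s - 40] elements.
   Each private part has at least [41 - 28 = 13] elements. The bound is tight, for instance for
   intersections 14, 14, 14, which give [2 + 13 + 13 + 13], and 14, 14, 12, which give
   [0 + 13 + 14 + 14]. *)
have leM : 41 <= #|M|.
  have := card_pairwise_ge A41 B41 C41.
  rewrite cM cA' cB' cC'; lia.
have [N sN cN] := ex_subset_card leM.
have inN i : i \in N -> [|| [&& i \notin A, i \notin B & i \notin C],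
                             i \in A', i \in B' | i \in C'].
  by move/(subsetP sN); rewrite !inE !negb_or -!orbA -andbA.
exists N; split; split=> //.
1-3: apply/setP=> i; rewrite !inE;
    have := inN i; have := inA' i; have := inB' i; have := inC' i;
    case: (i \in N) => //=;
    case: (i \in A); case: (i \in B); case: (i \in C) => //=;
    case: (i \in A'); case: (i \in B'); case: (i \in C') => //= H1 H2 H3 H4;
    solve [ by move: (H1 isT) | by move: (H2 isT) | by move: (H3 isT)
          | by move: (H4 isT) ].
- have sub : N :&: A \subset A'.
    apply/subsetP=> i; rewrite inE.
    case/andP=> /inN/or4P[/and3P[/negPf->]||/inB'|/inC'] //.
    1-2: by case/and3P=> /negPf->.
  by rewrite (leq_trans (subset_leq_card sub)) // cA' geq_minl.
- have sub : N :&: B \subset B'.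
    apply/subsetP=> i; rewrite inE.
    case/andP=> /inN/or4P[/and3P[_ /negPf->]|/inA'||/inC'] //.
    1-2: by case/and3P=> _ /negPf->.
  by rewrite (leq_trans (subset_leq_card sub)) // cB' geq_minl.
- have sub : N :&: C \subset C'.
    apply/subsetP=> i; rewrite inE.
    case/andP=> /inN/or4P[/and3P[_ _ /negPf->]|/inA'|/inB'|] //.
    1-2: by case/and3P=> _ _ /negPf->.
  by rewrite (leq_trans (subset_leq_card sub)) // cC' geq_minl.
Qed.

(** * Inserting a vertex in a negative triangle *)

(** A colour on all three vertices would have a potential whose differences sum to zero around the
    triangle, making its sign positive. *)
Lemma good_negative_triangle (V : finType) (G : sgraph V) c (x y z : V) :
  good G c -> adj G x y -> adj G y z -> adj G z x ->
  negative_cycle G [:: x; y; z] -> c x :&: c y :&: c z = set0.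
Proof.
move=> [_ _ cP] xy yz zx /negative_triangle_neg nxyz.
apply/setP=> i; rewrite !inE; apply/negP=> /andP[/andP[ix iy] iz].
have [s sP] := cP i; move: nxyz; rewrite !(sP _ _ _ _ _) ?inE //.
by case: (s x); case: (s y); case: (s z).
Qed.

(** Each colour of the new vertex is on at most one of its neighbours, so its class gains at most
    one edge, and the potential at the new vertex can be chosen to fit that edge. *)
Lemma good_triangle_insertion (U V : finType)
    (H : plane_sgraph U) (G : plane_sgraph V) c :
  triangle_insertion H G -> good H c -> exists c', good G c'.
Proof.
case=> f [n [x [y [z]]]] [[tH negH [fI indf _]] [[nf cov nadj] _]].
case: tH => -[xy yz zx] _ gc; have [c41 ce cP] := gc.
have xyz0 := good_negative_triangle gc xy yz zx negH.
have le14 a b : adj H a b -> #|c a :&: c b| <= 14 by case/ce/andP.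
have xz : adj H x z by rewrite adj_sym.
have [N []] := ex_fourth_set (c41 x) (c41 y) (c41 z) xyz0
  (le14 _ _ xy) (le14 _ _ xz) (le14 _ _ yz).
move=> [N41 Nxy Nxz Nyz] [Nx Ny Nz].
(* The default [d] is the value given to the new vertex [n], the only vertex outside the image of
   [f]. *)
pose ext (T : Type) (F : U -> T) (d : T) p :=
  if [pick a | f a == p] is Some a then F a else d.
have ext_f T F (d : T) a : ext T F d (f a) = F a.
  by rewrite /ext; case: pickP => [b /eqP/fI-> //|/(_ a)]; rewrite eqxx.
have ext_n T F (d : T) : ext T F d n = d.
  rewrite /ext; case: pickP => // a /eqP fa.
  by case/negP: nf; apply/codomP; exists a.
have adjf a b : adj G (f a) (f b) = adj H a b := indf.1 a b.
have negf a b : neg G (f a) (f b) = neg H a b := indf.2 a b.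
have Nge a b : adj H a b -> #|N :&: c b| <= 14 -> 12 <= #|N :&: c a|.
  move=> ab Nb; have := card_pairwise_ge N41 (c41 a) (c41 b).
  have := le14 _ _ ab; lia.
have Ne p : adj G n p -> 12 <= #|N :&: ext _ c N p| <= 14.
  rewrite nadj !inE => /or3P[] /eqP->; rewrite ext_f.
  - by rewrite Nx andbT (Nge x y).
  - by rewrite Ny andbT (Nge y z).
  - by rewrite Nz andbT (Nge z x).
exists (ext _ c N); split.
- by move=> p; case: (cov p) => [->|/codomP[a ->]]; rewrite ?ext_n ?ext_f.
- move=> p q; case: (cov p) => [->|/codomP[a ->]].
    by rewrite ext_n; apply: Ne.
  case: (cov q) => [->|/codomP[b ->]]; last by rewrite adjf !ext_f; apply: ce.
  by rewrite adj_sym ext_n setIC; apply: Ne.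
move=> i; have [s sP] := cP i.
(* The value is dictated by the edge from [n] to the neighbour carrying [i]. If no neighbour carries
   [i], the last branch gives a harmless value. *)
pose sn := if i \in c x then neg G n (f x) (+) s x
           else if i \in c y then neg G n (f y) (+) s y
           else neg G n (f z) (+) s z.
have snP p : i \in N -> i \in ext _ c N p -> adj G n p ->
    neg G n p = sn (+) ext _ s sn p.
  move=> iN; rewrite nadj !inE /sn.
  have := in_set0 i; rewrite -{1}Nxy !inE iN /= => Exy.
  have := in_set0 i; rewrite -{1}Nxz !inE iN /= => Exz.
  have := in_set0 i; rewrite -{1}Nyz !inE iN /= => Eyz.
  move=> ip /or3P[] /eqP Ep; move: ip Exy Exz Eyz; rewrite Ep !ext_f => ->.
  - by rewrite -addbA addbb addbF.
  - by rewrite andbT => ->; rewrite -addbA addbb addbF.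
  - by rewrite !andbT => _ -> ->; rewrite -addbA addbb addbF.
exists (ext _ s sn) => p q; rewrite !inE.
case: (cov p) => [->|/codomP[a ->]].
  by rewrite !ext_n => iN iq nq; apply: snP.
case: (cov q) => [->|/codomP[b ->]].
  rewrite !ext_n => ia iN; rewrite adj_sym neg_sym addbC; exact: snP.
by rewrite adjf negf !ext_f => ia ib ab; apply: sP; rewrite ?inE.
Qed.

(** * Colourings of W' *)

Lemma card_nth_count (T : Type) (x0 : T) (P : pred T) (s : seq T) n :
  size s = n -> #|[set i : 'I_n | P (nth x0 s i)]| = count P s.
Proof.
move=> <-; rewrite cardsE cardE size_filter -enumT.
rewrite -[in RHS](mkseq_nth x0 s) /mkseq -val_enum_ord -map_comp count_map.
exact: eq_count.
Qed.

(* A colour class of W' is the row of its 16 vertices: 0 outside the class, 1 or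
   2 inside it according to the value of a potential.  A table lists classes
   with multiplicities.  The three tables below were found by rounding solutions
   of the linear program over all balanced sets of W'; 14 is the largest number
   of common colours of u and v for which that program is feasible. *)
Definition in_class (r : seq nat) (p : nat) : bool := nth 0 r p != 0.
Definition side (r : seq nat) (p : nat) : bool := nth 0 r p == 2.
Definition expand (t : seq (nat * seq nat)) : seq (seq nat) :=
  flatten [seq nseq kr.1 kr.2 | kr <- t].

Definition W'_edges := What.pos_edges' ++ What.neg_edges'.

(** A form of [good What.W'] that evaluation decides. Signs are looked up in both orders of the
    ends, as in [listed]. *)
Definition valid_table (rows : seq (seq nat)) : bool :=
  [&& size rows == 83,
      all (fun p => count (in_class^~ p) rows == 41) (iota 0 16),
      all (fun e => 12 <= count (fun r => in_class r e.1 && in_class r e.2) rows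
                      <= 14) W'_edges
    & all (fun e => all (fun r => in_class r e.1 && in_class r e.2 ==>
         (((e \in What.neg_edges') || ((e.2, e.1) \in What.neg_edges'))
            == (side r e.1 (+) side r e.2))) rows) W'_edges].

Definition table_coloring (rows : seq (seq nat)) (q : 'I_16) : {set 'I_83} :=
  [set i : 'I_83 | in_class (nth [::] rows i) q].

Lemma card_table_coloringI rows p q : size rows = 83 ->
  #|table_coloring rows p :&: table_coloring rows q| =
  count (fun r => in_class r p && in_class r q) rows.
Proof.
move=> rows83; rewrite -(card_nth_count [::] _ rows83).
by apply: eq_card => i; rewrite !inE.
Qed.

Lemma table_coloring_good rows :
  valid_table rows -> good What.W' (table_coloring rows).
Proof.
case/and4P=> /eqP rows83 /allP r41 /allP re /allP rP.
have edgeP (i j : 'I_16) : adj What.W' i j ->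
    (i : nat, j : nat) \in W'_edges \/ (j : nat, i : nat) \in W'_edges.
  by case/andP=> _ /orP.
have negE (i j : 'I_16) : adj What.W' i j -> neg What.W' i j =
    ((i : nat, j : nat) \in What.neg_edges')
    || ((j : nat, i : nat) \in What.neg_edges').
  by rewrite /= /listed => /andP[->].
split=> [q|i j|k].
- rewrite (card_nth_count [::] (in_class^~ q) rows83).
  by apply/eqP/r41; rewrite mem_iota /= add0n ltn_ord.
- by case/edgeP=> /re /=; last rewrite setIC; rewrite card_table_coloringI.
exists (fun q : 'I_16 => side (nth [::] rows k) q) => i j.
rewrite !inE => ki kj ij.
have kr : nth [::] rows k \in rows by rewrite mem_nth // rows83.
rewrite negE //; case: (edgeP _ _ ij) => /rP/allP/(_ _ kr) /=.
  by rewrite ki kj => /eqP.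
by rewrite ki kj orbC addbC => /eqP.
Qed.

Definition classes12 : seq (nat * seq nat) := [::
  (5, [:: 0; 1; 0; 0; 0; 2; 1; 2; 0; 1; 0; 1; 0; 1; 2; 0]);
  (5, [:: 1; 0; 2; 2; 2; 0; 0; 1; 0; 0; 1; 2; 0; 0; 2; 1]);
  (4, [:: 1; 0; 0; 0; 0; 0; 1; 2; 1; 2; 2; 0; 0; 0; 0; 2]);
  (4, [:: 0; 1; 2; 2; 2; 0; 1; 0; 0; 1; 2; 0; 1; 2; 0; 1]);
  (3, [:: 0; 1; 0; 0; 0; 1; 2; 0; 1; 2; 0; 2; 0; 0; 0; 1]);
  (3, [:: 1; 0; 0; 0; 2; 2; 0; 2; 1; 0; 1; 0; 0; 0; 1; 2]);
  (2, [:: 1; 2; 1; 0; 0; 0; 0; 0; 0; 2; 2; 0; 1; 1; 0; 0]);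
  (2, [:: 1; 0; 1; 0; 2; 2; 0; 2; 0; 0; 0; 2; 0; 0; 1; 0]);
  (2, [:: 1; 0; 0; 2; 0; 2; 0; 1; 2; 0; 1; 2; 0; 0; 2; 0]);
  (2, [:: 1; 0; 0; 0; 0; 0; 1; 2; 1; 2; 0; 0; 1; 0; 1; 0]);
  (2, [:: 0; 0; 1; 1; 1; 2; 0; 2; 0; 0; 0; 1; 2; 0; 1; 0]);
  (2, [:: 0; 1; 0; 0; 2; 2; 1; 2; 0; 1; 0; 0; 2; 1; 2; 0]);
  (2, [:: 0; 1; 2; 2; 2; 0; 1; 0; 0; 1; 0; 1; 2; 1; 2; 0]);
  (2, [:: 1; 2; 0; 0; 0; 0; 1; 0; 2; 0; 0; 0; 1; 1; 0; 2]);
  (2, [:: 0; 0; 1; 1; 1; 0; 2; 0; 2; 0; 1; 0; 2; 1; 0; 2]);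
  (2, [:: 1; 0; 1; 2; 0; 2; 0; 0; 2; 0; 1; 2; 0; 0; 2; 1]);
  (1, [:: 1; 2; 0; 0; 0; 2; 1; 0; 2; 0; 0; 0; 0; 0; 0; 0]);
  (1, [:: 1; 2; 0; 0; 0; 2; 0; 1; 2; 0; 1; 0; 0; 0; 0; 0]);
  (1, [:: 0; 0; 1; 1; 1; 2; 0; 2; 0; 0; 1; 2; 0; 1; 0; 0]);
  (1, [:: 1; 2; 0; 0; 0; 0; 0; 1; 0; 2; 1; 2; 0; 2; 0; 0]);
  (1, [:: 0; 1; 0; 2; 0; 0; 1; 0; 1; 2; 2; 1; 0; 2; 0; 0]);
  (1, [:: 0; 1; 2; 0; 2; 0; 1; 0; 0; 1; 0; 0; 1; 1; 0; 0]);
  (1, [:: 1; 2; 0; 0; 0; 0; 0; 1; 0; 2; 0; 0; 1; 2; 0; 0]);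
  (1, [:: 1; 2; 2; 0; 0; 0; 0; 1; 0; 0; 2; 0; 1; 2; 0; 0]);
  (1, [:: 0; 1; 0; 2; 0; 1; 0; 0; 1; 2; 2; 0; 1; 2; 0; 0]);
  (1, [:: 0; 1; 1; 0; 2; 2; 0; 2; 0; 0; 0; 1; 2; 1; 0; 0]);
  (1, [:: 0; 1; 2; 2; 0; 1; 0; 0; 1; 0; 0; 2; 1; 2; 0; 0]);
  (1, [:: 0; 0; 0; 1; 1; 1; 0; 0; 2; 0; 0; 2; 1; 1; 0; 0]);
  (1, [:: 0; 1; 2; 2; 2; 1; 0; 0; 1; 0; 0; 2; 1; 2; 0; 0]);
  (1, [:: 0; 1; 0; 0; 0; 2; 1; 2; 0; 1; 0; 0; 2; 0; 2; 0]);
  (1, [:: 1; 2; 2; 0; 0; 0; 0; 1; 0; 0; 2; 0; 1; 0; 1; 0]);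
  (1, [:: 0; 0; 0; 1; 1; 1; 0; 2; 0; 0; 0; 2; 1; 0; 1; 0]);
  (1, [:: 0; 0; 1; 1; 1; 2; 0; 0; 2; 0; 0; 1; 2; 0; 2; 0]);
  (1, [:: 0; 0; 0; 1; 2; 1; 0; 2; 1; 0; 0; 2; 1; 0; 1; 0]);
  (1, [:: 1; 0; 0; 0; 2; 2; 0; 1; 0; 0; 0; 2; 0; 2; 1; 0]);
  (1, [:: 0; 1; 2; 2; 2; 0; 1; 0; 0; 1; 0; 1; 0; 1; 2; 0]);
  (1, [:: 0; 0; 0; 1; 1; 1; 0; 2; 0; 2; 2; 1; 0; 1; 2; 0]);
  (1, [:: 1; 2; 0; 0; 0; 0; 1; 0; 0; 2; 0; 0; 1; 2; 1; 0]);
  (1, [:: 0; 1; 1; 0; 0; 0; 2; 0; 0; 2; 0; 2; 1; 1; 2; 0]);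
  (1, [:: 1; 0; 2; 2; 2; 0; 0; 0; 1; 0; 1; 0; 0; 0; 0; 1]);
  (1, [:: 1; 0; 1; 2; 0; 2; 0; 0; 2; 0; 1; 0; 0; 0; 0; 1]);
  (1, [:: 0; 1; 2; 2; 0; 1; 0; 0; 1; 0; 2; 0; 0; 0; 0; 1]);
  (1, [:: 1; 0; 1; 2; 0; 0; 0; 0; 2; 0; 2; 0; 1; 0; 0; 1]);
  (1, [:: 0; 1; 2; 2; 2; 0; 1; 0; 0; 1; 2; 0; 1; 0; 0; 1]);
  (1, [:: 1; 0; 2; 2; 2; 0; 0; 0; 1; 0; 0; 2; 1; 0; 0; 1]);
  (1, [:: 1; 2; 0; 0; 0; 2; 1; 0; 2; 0; 0; 0; 0; 1; 0; 2]);
  (1, [:: 1; 0; 0; 0; 0; 0; 1; 0; 1; 2; 2; 0; 0; 2; 0; 1]);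
  (1, [:: 1; 0; 2; 0; 2; 0; 1; 0; 1; 0; 0; 0; 1; 2; 0; 1]);
  (1, [:: 0; 1; 2; 0; 2; 0; 1; 0; 0; 1; 0; 0; 1; 2; 0; 1]);
  (1, [:: 0; 1; 0; 2; 0; 0; 1; 0; 1; 2; 0; 0; 1; 2; 0; 1]);
  (1, [:: 0; 0; 0; 1; 1; 1; 2; 0; 2; 0; 0; 2; 1; 1; 0; 2]);
  (1, [:: 1; 0; 1; 0; 0; 0; 0; 2; 0; 2; 1; 0; 0; 0; 1; 2]);
  (1, [:: 0; 0; 1; 1; 1; 2; 0; 0; 2; 0; 0; 1; 0; 0; 2; 1]);
  (1, [:: 0; 0; 0; 1; 1; 1; 0; 2; 0; 2; 2; 1; 0; 0; 1; 2]);
  (1, [:: 1; 0; 0; 2; 0; 0; 1; 0; 1; 2; 2; 0; 1; 0; 1; 2])].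

Definition classes13 : seq (nat * seq nat) := [::
  (5, [:: 0; 1; 0; 0; 2; 2; 1; 2; 0; 1; 0; 0; 2; 0; 2; 0]);
  (5, [:: 0; 1; 2; 2; 0; 0; 1; 0; 0; 1; 0; 1; 2; 1; 2; 0]);
  (5, [:: 1; 0; 0; 0; 0; 0; 1; 2; 1; 2; 0; 0; 1; 0; 0; 2]);
  (4, [:: 0; 1; 2; 2; 2; 0; 1; 0; 0; 1; 2; 0; 1; 2; 0; 1]);
  (3, [:: 1; 0; 1; 0; 2; 2; 0; 2; 0; 0; 0; 2; 0; 0; 1; 0]);
  (3, [:: 0; 1; 0; 0; 0; 1; 2; 0; 1; 2; 0; 2; 0; 2; 0; 1]);
  (2, [:: 1; 2; 0; 0; 0; 2; 0; 1; 2; 0; 1; 0; 0; 0; 0; 0]);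
  (2, [:: 1; 2; 2; 0; 0; 0; 0; 1; 0; 0; 1; 2; 0; 2; 0; 0]);
  (2, [:: 1; 2; 0; 0; 0; 0; 0; 1; 0; 2; 1; 2; 0; 2; 0; 0]);
  (2, [:: 1; 2; 0; 0; 0; 0; 1; 0; 2; 0; 2; 0; 1; 1; 0; 0]);
  (2, [:: 1; 0; 0; 0; 0; 0; 1; 2; 1; 2; 2; 0; 0; 0; 1; 0]);
  (2, [:: 0; 0; 0; 1; 1; 1; 0; 2; 0; 2; 2; 1; 0; 1; 2; 0]);
  (2, [:: 1; 0; 2; 2; 2; 0; 0; 0; 1; 0; 2; 0; 1; 2; 1; 0]);
  (2, [:: 1; 0; 1; 2; 0; 2; 0; 0; 2; 0; 1; 0; 0; 0; 0; 1]);
  (2, [:: 0; 0; 0; 1; 2; 1; 0; 2; 1; 0; 0; 2; 1; 0; 0; 2]);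
  (2, [:: 1; 0; 1; 2; 0; 2; 0; 0; 2; 0; 0; 2; 0; 0; 2; 1]);
  (2, [:: 1; 2; 0; 0; 0; 0; 1; 0; 0; 2; 2; 0; 1; 0; 1; 2]);
  (2, [:: 0; 0; 0; 1; 1; 1; 2; 0; 2; 0; 0; 2; 1; 0; 2; 1]);
  (1, [:: 1; 2; 1; 0; 0; 0; 0; 0; 0; 2; 1; 0; 0; 1; 0; 0]);
  (1, [:: 0; 1; 1; 0; 0; 0; 2; 0; 0; 2; 1; 0; 0; 1; 0; 0]);
  (1, [:: 0; 1; 0; 2; 0; 1; 0; 0; 1; 2; 0; 1; 0; 2; 0; 0]);
  (1, [:: 0; 1; 0; 0; 2; 2; 1; 2; 0; 0; 0; 0; 2; 1; 0; 0]);
  (1, [:: 0; 1; 0; 0; 0; 1; 2; 0; 1; 2; 0; 0; 1; 2; 0; 0]);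
  (1, [:: 0; 1; 2; 2; 2; 0; 1; 0; 0; 1; 2; 0; 1; 1; 0; 0]);
  (1, [:: 0; 1; 2; 2; 2; 1; 0; 0; 1; 0; 0; 2; 1; 2; 0; 0]);
  (1, [:: 1; 0; 0; 2; 0; 2; 0; 1; 2; 0; 1; 0; 0; 0; 2; 0]);
  (1, [:: 0; 1; 0; 0; 0; 0; 1; 2; 0; 1; 0; 1; 0; 0; 2; 0]);
  (1, [:: 0; 0; 1; 1; 1; 2; 0; 2; 0; 0; 1; 2; 0; 0; 1; 0]);
  (1, [:: 1; 0; 1; 0; 2; 0; 0; 2; 0; 0; 1; 0; 0; 1; 2; 0]);
  (1, [:: 1; 0; 1; 0; 0; 0; 0; 2; 0; 2; 1; 0; 0; 1; 2; 0]);
  (1, [:: 0; 1; 1; 0; 2; 2; 0; 2; 0; 0; 1; 2; 0; 1; 2; 0]);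
  (1, [:: 1; 0; 2; 2; 2; 0; 0; 1; 0; 0; 2; 0; 1; 2; 1; 0]);
  (1, [:: 0; 0; 0; 1; 1; 1; 0; 2; 0; 2; 0; 2; 1; 1; 2; 0]);
  (1, [:: 1; 2; 0; 0; 0; 2; 1; 0; 2; 0; 0; 0; 0; 0; 0; 2]);
  (1, [:: 1; 2; 1; 0; 0; 0; 0; 0; 2; 0; 1; 2; 0; 0; 0; 2]);
  (1, [:: 0; 1; 2; 2; 0; 1; 0; 0; 1; 0; 2; 1; 0; 0; 0; 1]);
  (1, [:: 1; 0; 0; 0; 2; 2; 0; 2; 1; 0; 1; 2; 0; 0; 0; 2]);
  (1, [:: 1; 0; 0; 2; 2; 2; 0; 0; 1; 0; 0; 2; 0; 2; 0; 1]);
  (1, [:: 1; 0; 2; 2; 2; 0; 0; 1; 0; 0; 1; 2; 0; 2; 0; 1]);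
  (1, [:: 1; 0; 2; 2; 2; 0; 0; 0; 1; 0; 0; 0; 1; 2; 0; 1]);
  (1, [:: 1; 0; 2; 2; 2; 0; 0; 0; 1; 0; 2; 0; 1; 2; 0; 1]);
  (1, [:: 0; 1; 2; 0; 2; 0; 1; 0; 0; 1; 2; 0; 1; 2; 0; 1]);
  (1, [:: 0; 0; 1; 1; 1; 2; 0; 2; 0; 0; 0; 1; 2; 1; 0; 2]);
  (1, [:: 0; 1; 0; 2; 0; 0; 1; 0; 1; 2; 0; 1; 2; 2; 0; 1]);
  (1, [:: 1; 0; 0; 0; 0; 2; 1; 0; 1; 0; 0; 0; 0; 0; 1; 2]);
  (1, [:: 1; 0; 2; 2; 2; 0; 1; 0; 1; 0; 2; 0; 0; 0; 1; 2]);
  (1, [:: 0; 0; 0; 1; 0; 1; 0; 2; 1; 2; 2; 0; 0; 0; 1; 2]);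
  (1, [:: 0; 0; 1; 1; 1; 2; 0; 2; 0; 0; 0; 1; 0; 0; 1; 2]);
  (1, [:: 1; 0; 2; 2; 2; 0; 0; 0; 1; 0; 0; 2; 0; 0; 1; 2]);
  (1, [:: 0; 0; 0; 1; 1; 1; 0; 2; 0; 0; 2; 1; 0; 0; 1; 2]);
  (1, [:: 0; 0; 1; 1; 1; 2; 0; 2; 0; 0; 1; 2; 0; 0; 1; 2]);
  (1, [:: 0; 0; 1; 0; 1; 0; 2; 0; 2; 0; 0; 2; 1; 0; 2; 1])].

Definition classes14 : seq (nat * seq nat) := [::
  (6, [:: 1; 0; 0; 0; 0; 0; 1; 2; 1; 2; 0; 0; 1; 0; 0; 2]);
  (4, [:: 0; 1; 2; 2; 2; 0; 1; 0; 0; 1; 2; 0; 1; 2; 0; 1]);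
  (4, [:: 0; 1; 0; 0; 0; 1; 2; 0; 1; 2; 0; 2; 1; 2; 0; 1]);
  (4, [:: 1; 0; 2; 2; 2; 0; 0; 0; 1; 0; 2; 0; 1; 0; 1; 2]);
  (3, [:: 1; 0; 0; 2; 0; 2; 0; 1; 2; 0; 1; 2; 0; 0; 2; 0]);
  (3, [:: 0; 1; 0; 0; 2; 2; 1; 2; 0; 1; 0; 1; 0; 1; 2; 0]);
  (3, [:: 0; 0; 1; 1; 1; 2; 0; 0; 2; 0; 0; 1; 0; 1; 0; 2]);
  (2, [:: 1; 2; 0; 0; 0; 2; 0; 1; 2; 0; 1; 0; 0; 0; 0; 0]);
  (2, [:: 1; 2; 0; 0; 0; 0; 1; 0; 2; 0; 2; 0; 0; 1; 0; 0]);
  (2, [:: 1; 2; 1; 0; 0; 0; 0; 0; 0; 2; 1; 0; 0; 1; 0; 0]);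
  (2, [:: 0; 1; 2; 2; 2; 0; 1; 0; 0; 1; 0; 1; 2; 1; 0; 0]);
  (2, [:: 1; 0; 1; 0; 2; 2; 0; 2; 0; 0; 0; 2; 0; 0; 1; 0]);
  (2, [:: 1; 2; 0; 0; 0; 0; 1; 0; 0; 2; 2; 0; 0; 2; 1; 0]);
  (2, [:: 0; 1; 2; 2; 0; 0; 1; 0; 0; 1; 0; 0; 1; 1; 2; 0]);
  (2, [:: 1; 2; 0; 0; 0; 0; 0; 1; 0; 2; 2; 0; 1; 2; 1; 0]);
  (2, [:: 1; 2; 0; 0; 0; 2; 1; 0; 2; 0; 0; 0; 0; 0; 0; 2]);
  (2, [:: 0; 0; 0; 1; 1; 1; 0; 2; 0; 2; 0; 2; 1; 0; 1; 2]);
  (1, [:: 0; 1; 0; 0; 2; 0; 1; 2; 0; 1; 2; 0; 0; 1; 0; 0]);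
  (1, [:: 0; 1; 1; 0; 2; 2; 0; 2; 0; 0; 1; 2; 0; 1; 0; 0]);
  (1, [:: 1; 2; 2; 0; 0; 0; 0; 1; 0; 0; 0; 0; 1; 2; 0; 0]);
  (1, [:: 0; 1; 0; 0; 2; 2; 1; 2; 0; 0; 0; 0; 2; 1; 0; 0]);
  (1, [:: 0; 1; 0; 2; 0; 0; 1; 0; 1; 2; 2; 0; 1; 2; 0; 0]);
  (1, [:: 0; 1; 0; 0; 0; 2; 1; 2; 0; 1; 0; 1; 2; 1; 0; 0]);
  (1, [:: 0; 1; 0; 0; 0; 1; 2; 0; 1; 2; 0; 2; 1; 2; 0; 0]);
  (1, [:: 1; 2; 2; 0; 0; 0; 0; 1; 0; 0; 1; 0; 0; 0; 1; 0]);
  (1, [:: 1; 0; 2; 2; 2; 0; 0; 1; 0; 0; 1; 0; 0; 0; 1; 0]);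
  (1, [:: 0; 0; 0; 1; 2; 1; 0; 2; 1; 0; 0; 1; 0; 0; 1; 0]);
  (1, [:: 1; 0; 1; 0; 2; 0; 0; 2; 0; 0; 1; 2; 0; 0; 1; 0]);
  (1, [:: 0; 0; 1; 1; 1; 2; 0; 2; 0; 0; 1; 2; 0; 0; 1; 0]);
  (1, [:: 0; 0; 0; 1; 0; 1; 0; 2; 1; 2; 2; 1; 0; 0; 1; 0]);
  (1, [:: 0; 0; 1; 1; 1; 2; 0; 2; 0; 0; 0; 1; 2; 0; 1; 0]);
  (1, [:: 0; 0; 1; 1; 1; 2; 0; 0; 2; 0; 0; 1; 2; 0; 2; 0]);
  (1, [:: 1; 0; 1; 0; 2; 2; 0; 2; 0; 0; 1; 2; 0; 1; 2; 0]);
  (1, [:: 1; 0; 1; 0; 0; 0; 0; 2; 0; 2; 1; 2; 0; 1; 2; 0]);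
  (1, [:: 1; 0; 0; 0; 0; 0; 1; 2; 0; 2; 0; 0; 1; 1; 2; 0]);
  (1, [:: 0; 1; 0; 0; 0; 2; 1; 2; 0; 1; 0; 0; 2; 1; 2; 0]);
  (1, [:: 0; 1; 2; 2; 2; 0; 1; 0; 0; 1; 0; 1; 2; 1; 2; 0]);
  (1, [:: 1; 0; 0; 2; 0; 2; 0; 0; 1; 0; 1; 0; 0; 0; 0; 1]);
  (1, [:: 0; 0; 1; 1; 1; 2; 0; 2; 0; 0; 0; 1; 0; 0; 0; 2]);
  (1, [:: 1; 0; 1; 2; 0; 2; 0; 0; 2; 0; 0; 2; 0; 0; 0; 1]);
  (1, [:: 1; 0; 2; 2; 2; 0; 0; 1; 0; 0; 1; 2; 0; 0; 0; 1]);
  (1, [:: 0; 1; 2; 2; 0; 1; 0; 0; 1; 0; 2; 1; 0; 0; 0; 1]);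
  (1, [:: 0; 1; 0; 2; 0; 1; 0; 0; 1; 2; 0; 1; 0; 2; 0; 1]);
  (1, [:: 1; 0; 2; 2; 2; 0; 0; 0; 1; 0; 1; 2; 0; 2; 0; 1]);
  (1, [:: 0; 0; 0; 0; 1; 1; 2; 0; 2; 0; 0; 2; 1; 1; 0; 2]);
  (1, [:: 1; 0; 2; 2; 2; 0; 1; 0; 1; 0; 2; 0; 0; 0; 1; 2]);
  (1, [:: 1; 0; 0; 2; 2; 2; 0; 1; 0; 0; 0; 2; 0; 0; 2; 1]);
  (1, [:: 0; 0; 1; 1; 1; 0; 2; 0; 2; 0; 1; 2; 0; 0; 2; 1]);
  (1, [:: 1; 0; 0; 0; 0; 2; 0; 1; 2; 0; 1; 2; 0; 0; 2; 1]);
  (1, [:: 0; 1; 2; 2; 0; 0; 1; 0; 0; 1; 0; 0; 1; 0; 2; 1]);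
  (1, [:: 0; 0; 1; 1; 1; 2; 0; 2; 0; 0; 1; 0; 2; 0; 1; 2]);
  (1, [:: 0; 0; 1; 1; 1; 0; 2; 0; 2; 0; 1; 0; 2; 0; 2; 1]);
  (1, [:: 0; 1; 2; 0; 2; 0; 1; 0; 0; 1; 2; 0; 1; 0; 2; 1])].

Lemma W'_good e : 12 <= e <= 14 -> exists2 c : 'I_16 -> {set 'I_83},
  good What.W' c & #|c What.W'_u :&: c What.W'_v| = e.
Proof.
move=> e_range; suff [rows rowsP rowse] : exists2 rows, valid_table rows &
    count (fun r => in_class r What.u && in_class r What.v) rows = e.
  exists (table_coloring rows); first exact: table_coloring_good.
  by case/andP: rowsP => /eqP rows83 _; rewrite card_table_coloringI.
have : e \in [:: 12; 13; 14] by rewrite !inE; lia.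
rewrite !inE => /or3P[] /eqP->.
- by exists (expand classes12); vm_compute.
- by exists (expand classes13); vm_compute.
- by exists (expand classes14); vm_compute.
Qed.

(** * Matching colour sets by renaming the colours *)

Lemma ex_perm_fibers (K : eqType) n (h h' : 'I_n -> K) :
  (forall k, #|[set i | h i == k]| = #|[set i | h' i == k]|) ->
  exists r : 'S_n, forall i, h i = h' (r i).
Proof.
move=> hh'; have cnt (g : 'I_n -> K) k :
    count_mem k [seq g i | i <- enum 'I_n] = #|[set i | g i == k]|.
  by rewrite count_map cardsE cardE size_filter -enumT.
(* Equal fibre sizes say that the two tuples of values have the same multiplicities, hence differ by
   a permutation of the indices. *)
have /tuple_permP[r rP] : perm_eq [tuple h i | i < n] [tuple h' i | i < n].
  apply/allP=> k _; apply/eqP.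
  exact: etrans (cnt h k) (etrans (hh' k) (esym (cnt h' k))).
exists r => i; have /val_inj/(congr1 (fun t => tnth t i)) := rP.
by rewrite !tnth_mktuple.
Qed.

(** The three given cardinals determine the sizes of all four cells of the Venn diagram of two sets.
    The cells are the fibres of the map [h] recording the two memberships, so a permutation can
    match them. *)
Lemma ex_color_perm n (A B A' B' : {set 'I_n}) :
  #|A| = #|A'| -> #|B| = #|B'| -> #|A :&: B| = #|A' :&: B'| ->
  exists r : 'S_n, r @^-1: A' = A /\ r @^-1: B' = B.
Proof.
move=> eA eB eAB.
pose h (C D : {set 'I_n}) i := (i \in C, i \in D).
have fib C D k : #|[set i | h C D i == k]| =
    match k with
    | (true, true) => #|C :&: D|
    | (true, false) => #|C| - #|C :&: D|
    | (false, true) => #|D| - #|C :&: D|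
    | (false, false) => n - (#|C| + #|D| - #|C :&: D|)
    end.
  case: k => -[] [].
  2: rewrite -cardsD.
  3: rewrite setIC -cardsD.
  4: have <- : #|~: (C :|: D)| = n - (#|C| + #|D| - #|C :&: D|)
      by (have := cardsC (C :|: D); rewrite cardsU card_ord; lia).
  1-4: by apply: eq_card => i; rewrite !inE xpair_eqE; do 2!case: (_ \in _).
have [|r rP] := @ex_perm_fibers _ _ (h A B) (h A' B').
  by move=> k; rewrite !fib eA eB eAB.
by exists r; split; apply/setP=> i; rewrite inE; case: (rP i).
Qed.

(** The table is chosen by the number of common colours of [x] and [y]. Its colours are then renamed
    to agree with theirs at [u] and [v], and its potentials are switched to fit the copy in [G]. *)
Lemma good_W'_addition (U V : finType)
    (H : plane_sgraph U) (G : plane_sgraph V) c :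
  W'_addition H G -> good H c -> exists c', good G c'.
Proof.
case=> f [g [x [y [[xy [fI indf _] gI sw] [[fx fy fg] [cov adjP]]]]]] gc.
have [c41 ce _] := gc; have [c0 gc0 e0] := W'_good (ce _ _ xy).
have [c041 _ _] := gc0.
have [r [rx ry]] : exists r : 'S_83,
    r @^-1: c0 What.W'_u = c x /\ r @^-1: c0 What.W'_v = c y.
  by apply: ex_color_perm; rewrite ?c41 ?c041.
apply: (good_glue fI gI (good_same indf gc)
  (good_switching_equiv sw (good_inj (@perm_inj _ r) gc0)) _ fx fy fg cov adjP).
- by have := indf.1 x y; rewrite /= xy.
- by rewrite rx.
- by rewrite ry.
Qed.

(** The vertices [u], [v], [z] span a triangle with three negative edges in [W'], so a colouring of
    [W'] restricts to one of the starting graph; the choice of the table for 12 is arbitrary. *)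
Lemma good_K3 (V : finType) (G : plane_sgraph V) :
  #|V| = 3 -> same_sgraph G (negative_complete V) -> exists c, good G c.
Proof.
move=> V3 eqG; have [c gc _] := @W'_good 12 isT.
pose uvz : 3.-tuple 'I_16 :=
  [tuple What.W'_u; What.W'_v; @Ordinal 16 What.z isT].
pose h x := tnth uvz (cast_ord V3 (enum_rank x)).
exists (c \o h); apply: good_same eqG (good_pullback _ gc) => x y /= xy.
have : cast_ord V3 (enum_rank x) != cast_ord V3 (enum_rank y).
  by rewrite (inj_eq (@cast_ord_inj _ _ _)) (inj_eq enum_rank_inj).
rewrite xy /h; move: (cast_ord _ _) (cast_ord _ _).
by case=> [[|[|[|i]]] ?] // [[|[|[|j]]] ?].
Qed.

Theorem theorem4 (V : finType) (G : plane_sgraph V) (hG : built G) :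
  exists c : V -> {set 'I_83}, balanced_coloring G 41 c.
Proof.
suff [c gc] : exists c, good G c by exists c; apply: good_balanced_coloring.
elim: hG => {V G} [V G|U V H G _ [c gc]|U V H G _ [c gc]].
- exact: good_K3.
- by move/good_triangle_insertion/(_ gc).
- by move/good_W'_addition/(_ gc).
Qed.
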